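(* Let $M=\langle M,\ast,e,\leq\rangle$ be a commutative cancellative divisibility monoid. The following are equivalent: (1) Every $x\in M^{+}$ is primal. (2) For all $a,b,x,y\in M^{+}$ with $a\le x$, $a\le y$, $b\le x$, $b\le y$ there is $z\in M$ such that $a,b\leq z\leq x,y$. (3) For every positive integer $n$ and all $a,b,x_{1},\dots,x_{n}\in M^{+}$ with $a,b\leq x_{i}$ for all $i$, there is $z\in M$ such that $a,b\leq z\leq x_{i}$ for $i=1,\dots,n$. (4) For all positive integers $m,n$ and all $a_{1},\dots,a_m,b_{1},\dots,b_n\in M^{+}$ with $a_{i}\leq b_{j}$ for all $i,j$, there is $z\in M$ such that $a_{i}\leq z\leq b_{j}$ for all $i,j$.
   Context: A monoid is a commutative semigroup with identity, written $\langle M,\ast,e\rangle$. A partially ordered (p.o.) monoid $\langle M,\ast,e,\le\rangle$ is a monoid with a partial order such that $x\le y$ implies $z\ast x\le z\ast y$. Put $M^{+}=\{m\in M: m\ge e\}$. $M$ is a divisibility monoid if $x\le y$ in $M$ if and only if there is $a\in M^{+}$ with $y=x\ast a$. $M$ is cancellative if $z\ast x=z\ast y\Rightarrow x=y$ and $z\ast x\le z\ast y\Rightarrow x\le y$ for all $x,y,z\in M$. An element $x\in M^{+}$ is primal if whenever $x\le y_{1}\ast y_{2}$ with $y_{1},y_{2}\in M^{+}$ there are $x_{1},x_{2}\in M^{+}$ with $x=x_{1}\ast x_{2}$ and $x_{1}\le y_{1}$, $x_{2}\le y_{2}$. The notation $a,b\le z\le x,y$ means $a\le z$, $b\le z$,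 $z\le x$, $z\le y$. *)

(* Defs.v *)
From Stdlib Require Import Relation_Definitions.
From mathcomp Require Import all_boot.

Set Implicit Arguments.
Unset Strict Implicit.
Unset Printing Implicit Defensive.

Declare Scope pom_scope.
Delimit Scope pom_scope with pom.

(* "Monoid" means commutative monoid.  The carrier is an arbitrary [Type] and
   the order is [Prop]-valued, so neither equality nor order is assumed to be
   decidable. *)
Record po_monoid := POMonoid {
  pom_sort :> Type;
  pom_e : pom_sort;
  pom_mul : Monoid.com_law pom_e;
  pom_le : relation pom_sort;
  pom_le_order : Relation_Definitions.order pom_sort pom_le;
  pom_le_mul2l : forall x y z : pom_sort,
    pom_le x y -> pom_le (pom_mul z x) (pom_mul z y)
}.

Bind Scope pom_scope with pom_sort.
Notation "x * y" := (pom_mul _ x y) : pom_scope.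
Notation "x <= y" := (pom_le x y) : pom_scope.
Local Open Scope pom_scope.

Definition pos (M : po_monoid) (x : M) : Prop := pom_e M <= x.

Definition divisibility_monoid (M : po_monoid) : Prop :=
  forall x y : M, x <= y <-> exists a : M, pos a /\ y = x * a.

Definition cancellative (M : po_monoid) : Prop :=
  forall x y z : M,
    (z * x = z * y -> x = y) /\ (z * x <= z * y -> x <= y).

Definition primal (M : po_monoid) (x : M) : Prop :=
  forall y1 y2 : M, pos y1 -> pos y2 -> x <= y1 * y2 ->
  exists x1 x2 : M,
    [/\ pos x1, pos x2, x = x1 * x2, x1 <= y1 & x2 <= y2].

(* Main.v *)
Require Import Defs.
From Stdlib Require Import Relation_Definitions.
From mathcomp Require Import all_boot.

(** The engine is a dictionary between factorisations and interpolants.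

    If all positive elements are primal and [a, b <= x, y], split [b] over
    [x = a * u] as [b = b1 * b2] with [b1 <= a] and [b2 <= u].  Cancelling [b1]
    turns [b <= y = a * s] into [b2 <= a' * s] with [a = b1 * a'], and splitting
    [b2] again isolates a factor [d] of [b] that divides both [u] and [s] while
    the rest of [b] divides [a]; so [a * d] is an interpolant
    ([primal_interpolation]).

    Conversely, a factorisation of [x <= y1 * y2] is read off an interpolant
    [x, y2 <= z <= x * y2, y1 * y2]: the quotient of [z] by [y2] is the factor
    below [y1], and its complement in [x] is the factor below [y2]
    ([primal_of_interpolant]).

    In between, families of bounds are absorbed one element at a time.  An
    interpolant between [a, b] and some of the upper bounds is itself a new
    upper bound of [a, b], and dually an interpolant above some of the lower
    bounds replaces them all; so the two-by-two case yields every finite case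
    ([interpolation_upper], [interpolation_family]). *)

Local Open Scope pom_scope.

Lemma pom_le_refl {M : po_monoid} (x : M) : x <= x.
Proof. exact: (ord_refl _ _ (pom_le_order M)). Qed.

Lemma pom_le_trans {M : po_monoid} {x y z : M} : x <= y -> y <= z -> x <= z.
Proof. exact: (ord_trans _ _ (pom_le_order M)). Qed.

Lemma pos_le {M : po_monoid} {x y : M} : pos x -> x <= y -> pos y.
Proof. exact: pom_le_trans. Qed.

(** Associativity and commutativity are restated so that rewriting with them
   keeps the product in the form [pom_mul M], instead of exposing the weaker
   monoid structures that the generic laws are about. *)
Lemma pom_mulA {M : po_monoid} (x y z : M) : x * (y * z) = x * y * z.
Proof. exact: Monoid.mulmA. Qed.

Lemma pom_mulC {M : po_monoid} (x y : M) : x * y = y * x.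
Proof. exact: Monoid.mulmC. Qed.

Lemma pom_le_mul2r {M : po_monoid} (x y z : M) : x <= y -> x * z <= y * z.
Proof. by rewrite ![_ * z]pom_mulC; apply: pom_le_mul2l. Qed.

Lemma pom_le_mulr {M : po_monoid} (x y : M) : pos y -> x <= x * y.
Proof.
by move=> y_pos; rewrite -{1}[x](Monoid.mulm1 (pom_mul M)); apply: pom_le_mul2l.
Qed.

Lemma pom_le_mull {M : po_monoid} (x y : M) : pos y -> x <= y * x.
Proof. by rewrite pom_mulC; apply: pom_le_mulr. Qed.

Lemma pom_le_mul2l_inv {M : po_monoid} (M_canc : cancellative M) (x y z : M) :
  z * x <= z * y -> x <= y.
Proof. by have [_] := M_canc x y z. Qed.

Lemma pom_le_mul2r_inv {M : po_monoid} (M_canc : cancellative M) (x y z : M) :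
  x * z <= y * z -> x <= y.
Proof. by rewrite ![_ * z]pom_mulC; apply: pom_le_mul2l_inv. Qed.

Lemma pom_le_factor {M : po_monoid} (M_div : divisibility_monoid M) {x y : M} :
  x <= y -> exists2 a : M, pos a & y = x * a.
Proof. by case/M_div=> a [a_pos y_eq]; exists a. Qed.

(** The interpolant is [a * d], where [d] is what remains of [b] after
    removing its factors [b1] and [c] taken from [a], first with respect to [x]
    and then with respect to [y]. *)
Lemma primal_interpolation {M : po_monoid}
    (M_div : divisibility_monoid M) (M_canc : cancellative M) :
  (forall x : M, pos x -> primal x) ->
  forall a b x y : M, pos a -> pos b ->
    a <= x -> a <= y -> b <= x -> b <= y ->
    exists z : M, [/\ a <= z, b <= z, z <= x & z <= y].
Proof.
move=> all_primal a b x y a_pos b_pos.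
case/(pom_le_factor M_div)=> u u_pos ->; case/(pom_le_factor M_div)=> s s_pos ->.
move=> b_le_au b_le_as.
have [b1 [b2 [b1_pos b2_pos b_eq b1_le_a b2_le_u]]] :=
  all_primal b b_pos a u a_pos u_pos b_le_au.
have [a' a'_pos a_eq] := pom_le_factor M_div b1_le_a.
have b2_le_a's : b2 <= a' * s.
  apply: (pom_le_mul2l_inv M_canc _ _ b1).
  by rewrite pom_mulA -a_eq -b_eq.
have [c [d [c_pos d_pos b2_eq c_le_a' d_le_s]]] :=
  all_primal b2 b2_pos a' s a'_pos s_pos b2_le_a's.
exists (a * d); split.
- exact: pom_le_mulr.
- rewrite b_eq b2_eq a_eq -pom_mulA.
  by apply: pom_le_mul2l; apply: pom_le_mul2r.
- apply: pom_le_mul2l; apply: pom_le_trans b2_le_u.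
  by rewrite b2_eq; apply: pom_le_mull.
- exact: pom_le_mul2l.
Qed.

(** The interpolant of [a, b] and all but one of the [x i] is positive and lies
    above [a, b], so it can be interpolated against the remaining [x i]. *)
Lemma interpolation_upper {M : po_monoid} :
  (forall a b x y : M, pos a -> pos b -> pos x -> pos y ->
     a <= x -> a <= y -> b <= x -> b <= y ->
     exists z : M, [/\ a <= z, b <= z, z <= x & z <= y]) ->
  forall n (a b : M) (x : 'I_n.+1 -> M),
    pos a -> pos b -> (forall i, a <= x i /\ b <= x i) ->
    exists z : M, [/\ a <= z, b <= z & forall i, z <= x i].
Proof.
move=> interp n a b x a_pos b_pos; elim: n x => [|n IHn] x ab_le_x.
  have [a_le_x b_le_x] := ab_le_x ord0.
  by exists (x ord0); split=> // i; rewrite ord1; apply: pom_le_refl.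
have [z [a_le_z b_le_z z_le_x]] :=
  IHn (fun i => x (lift ord0 i)) (fun i => ab_le_x (lift ord0 i)).
have [a_le_x0 b_le_x0] := ab_le_x ord0.
have [w [a_le_w b_le_w w_le_z w_le_x0]] :=
  interp a b z (x ord0) a_pos b_pos (pos_le a_pos a_le_z)
    (pos_le a_pos a_le_x0) a_le_z a_le_x0 b_le_z b_le_x0.
exists w; split=> // i; case: (unliftP ord0 i) => [j ->|-> //].
exact: pom_le_trans w_le_z (z_le_x j).
Qed.

(** An interpolant above all but one of the [a i] stands in for these, leaving
    just two lower bounds for the [b j]. *)
Lemma interpolation_family {M : po_monoid} n :
  (forall (a b : M) (x : 'I_n -> M),
     pos a -> pos b -> (forall i, a <= x i /\ b <= x i) ->
     exists z : M, [/\ a <= z, b <= z & forall i, z <= x i]) ->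
  forall m (a : 'I_m.+1 -> M) (b : 'I_n -> M),
    (forall i, pos (a i)) -> (forall i j, a i <= b j) ->
    exists z : M, (forall i, a i <= z) /\ (forall j, z <= b j).
Proof.
move=> interp m a b a_pos a_le_b; elim: m a a_pos a_le_b => [|m IHm] a a_pos a_le_b.
  by exists (a ord0); split=> // i; rewrite ord1; apply: pom_le_refl.
have [z [a_le_z z_le_b]] :=
  IHm (fun i => a (lift ord0 i)) (fun i => a_pos (lift ord0 i))
    (fun i => a_le_b (lift ord0 i)).
have z_pos : pos z := pos_le (a_pos _) (a_le_z ord0).
have [w [a0_le_w z_le_w w_le_b]] :=
  interp (a ord0) z b (a_pos ord0) z_pos (fun j => conj (a_le_b ord0 j) (z_le_b j)).
exists w; split=> // i; case: (unliftP ord0 i) => [j ->|-> //].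
exact: pom_le_trans (a_le_z j) z_le_w.
Qed.

(** The factor [x1] is the quotient of [z] by [y2].  Cancelling [y2] from the
    two upper bounds of [z] gives [x1 <= x] and [x1 <= y1]; the complement [x2]
    of [x1] in [x] is below [y2] because [x1 * x2 = x <= z = x1 * y2]. *)
Lemma primal_of_interpolant {M : po_monoid}
    (M_div : divisibility_monoid M) (M_canc : cancellative M) (x y1 y2 z : M) :
  x <= z -> y2 <= z -> z <= x * y2 -> z <= y1 * y2 ->
  exists x1 x2 : M, [/\ pos x1, pos x2, x = x1 * x2, x1 <= y1 & x2 <= y2].
Proof.
move=> x_le_z /(pom_le_factor M_div)[x1 x1_pos z_eq].
move: x_le_z; rewrite {}z_eq [y2 * x1]pom_mulC => x_le.
move=> /(pom_le_mul2r_inv M_canc)/(pom_le_factor M_div)[x2 x2_pos x_eq].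
move=> /(pom_le_mul2r_inv M_canc) x1_le_y1.
exists x1, x2; split=> //.
by apply: (pom_le_mul2l_inv M_canc _ _ x1); rewrite -x_eq.
Qed.

Theorem theorem2p1 (M : po_monoid)
    (M_div : divisibility_monoid M) (M_canc : cancellative M) :
  [<-> (* (1) *)
       forall x : M, pos x -> primal x;
       (* (2) *)
       forall a b x y : M, pos a -> pos b -> pos x -> pos y ->
         a <= x -> a <= y -> b <= x -> b <= y ->
         exists z : M, [/\ a <= z, b <= z, z <= x & z <= y];
       (* (3) *)
       forall n : nat, (0 < n)%N ->
       forall (a b : M) (x : 'I_n -> M),
         pos a -> pos b -> (forall i, pos (x i)) ->
         (forall i, a <= x i /\ b <= x i) ->
         exists z : M, [/\ a <= z, b <= z & forall i, z <= x i];
       (* (4) *)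
       forall m n : nat, (0 < m)%N -> (0 < n)%N ->
       forall (a : 'I_m -> M) (b : 'I_n -> M),
         (forall i, pos (a i)) -> (forall j, pos (b j)) ->
         (forall i j, a i <= b j) ->
         exists z : M, (forall i, a i <= z) /\ (forall j, z <= b j)].
Proof.
tfae.
- move=> all_primal a b x y a_pos b_pos _ _.
  exact: primal_interpolation.
- move=> interp [//|n] _ a b x a_pos b_pos _.
  exact: interpolation_upper.
- move=> interp [//|m] n _ n_gt0 a b a_pos _.
  apply: interpolation_family => // c d x c_pos d_pos cd_le_x.
  apply: interp => // i.
  exact: pos_le c_pos (cd_le_x i).1.
- move=> interp x x_pos y1 y2 y1_pos y2_pos x_le_y.
  pose a (i : 'I_2) := if i == ord0 then x else y2.
  pose b (j : 'I_2) := if j == ord0 then x * y2 else y1 * y2.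
  have xy2_pos : pos (x * y2) := pos_le x_pos (pom_le_mulr x y2 y2_pos).
  have a_pos i : pos (a i) by rewrite /a; case: ifP.
  have b_pos j : pos (b j).
    by rewrite /b; case: ifP => // _; apply: pos_le x_pos x_le_y.
  have a_le_b i j : a i <= b j.
    rewrite /a /b; case: ifP => _; case: ifP => _ //.
    + exact: pom_le_mulr.
    + exact: pom_le_mull.
    + exact: pom_le_mull.
  have [z [a_le_z z_le_b]] := interp 2 2 isT isT a b a_pos b_pos a_le_b.
  exact: (primal_of_interpolant M_div M_canc _ _ _ z
            (a_le_z ord0) (a_le_z ord_max) (z_le_b ord0) (z_le_b ord_max)).
Qed.
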